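(* Let $(N,+,* )$ be a finite f-near-ring. Then $(N,+)$ is an elementary abelian group.
   Context: A near-ring $(N,+,* )$ is a (not necessarily abelian) group $(N,+)$ with identity element $0$ together with a semigroup $(N,* )$ satisfying the right distributive law $(a+b)*c=a*c+b*c$. It is zero symmetric if $0*n=n*0=0$ for all $n$. For a near-ring with multiplicative identity $1$, $U$ denotes the group of multiplicatively invertible elements (units), and for $u\in N$, $\psi_u:N\to N$ is $n\mapsto n*u$. An f-near-ring is a zero symmetric near-ring with identity such that for every unit $u$ with $\psi_u\ne\mathrm{id}$, the only $n\in N$ with $n*u=n$ is $n=0$. A group is elementary abelian if it is abelian and, for some prime $p$, every element $x$ satisfies $px=0$. *)

(* Defs.v *)
From mathcomp Require Import all_boot all_fingroup all_solvable.

Set Implicit Arguments.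
Unset Strict Implicit.
Unset Printing Implicit Defensive.

(* MathComp has no additive notation for groups that need not be abelian, so   *)
(* the additive group (N, +) of a near-ring is a groupType N: its operation    *)
(* _ * _, identity 1 and powers x ^+ k stand for +, 0 and multiples k x.       *)
(* The near-ring product is a separate operation mul on N.                     *)
Declare Scope near_ring_scope.
Notation "x + y" := (x * y)%g (only parsing) : near_ring_scope.
Notation "0" := (1%g) (only parsing) : near_ring_scope.
Local Open Scope near_ring_scope.

Section NearRing.

Variables (N : groupType) (mul : N -> N -> N) (one : N).

Record near_ring : Prop := NearRing {
  near_ring_mulA : associative mul;
  near_ring_mulDl : forall a b c, mul (a + b) c = mul a c + mul b c
}.

Definition zero_symmetric : Prop := left_zero 0 mul /\ right_zero 0 mul.

Definition mul_identity : Prop := left_id one mul /\ right_id one mul.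

Definition near_ring_unit (u : N) : Prop :=
  exists v, mul u v = one /\ mul v u = one.

Definition psi (u n : N) : N := mul n u.

(* one = 0 is not excluded: the zero near-ring is an f-near-ring.              *)
Record f_near_ring : Prop := FNearRing {
  f_near_ring_near_ring : near_ring;
  f_near_ring_zero_symmetric : zero_symmetric;
  f_near_ring_identity : mul_identity;
  f_near_ring_fixfree : forall u, near_ring_unit u -> ~ (psi u =1 id) ->
    forall n, mul n u = n -> n = 0
}.

End NearRing.

(* Main.v *)
Require Import Defs.
From mathcomp Require Import all_boot all_fingroup all_solvable.

(** Write [e] for the additive order of the identity [1].  Since
    [(k 1) * n = k n], the exponent of [(N, +)] is [e], and [k 1] is a unit
    whenever [k] is coprime to [e].  For such [k], if some multiple [j 1 <> 0] is
    fixed by right multiplication by [k 1], that is [e %| j (k - 1)], then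
    [k = 1] modulo [e].  Let [p] be the least prime factor of [e], and take
    [j = e / p], with [k = p + 1] if [p] is odd and [k = e - 1] if [p = 2]: this
    forces [e = p].  If [p = 2] the group has exponent 2, hence is abelian; if
    [p] is odd, right multiplication by [-1] is a fixed-point-free involutive
    automorphism, hence is the inversion, and again the group is abelian. *)

Set Implicit Arguments.
Unset Strict Implicit.
Unset Printing Implicit Defensive.

Import GroupScope.

(** A prime [q] dividing both numbers satisfies [pdiv e <= q <= (pdiv e).+1]. The upper value is
    even, so it would be 2 and [pdiv e] would be 1; the lower value would divide 1. *)
Lemma coprime_pdiv_succ e : 1 < e -> odd (pdiv e) -> coprime (pdiv e).+1 e.
Proof.
move=> e_gt1 odd_p; have p_pr := pdiv_prime e_gt1.
apply: contraT => ncop.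
have g_gt1 : 1 < gcdn (pdiv e).+1 e.
  by rewrite ltn_neqAle eq_sym ncop gcdn_gt0.
have q_pr := pdiv_prime g_gt1.
have := pdiv_dvd (gcdn (pdiv e).+1 e).
move: (pdiv _) q_pr => q q_pr; rewrite dvdn_gcd => /andP[q_p q_e].
have le_pq := pdiv_min_dvd (prime_gt1 q_pr) q_e.
have := dvdn_leq (ltn0Sn _) q_p.
rewrite leq_eqVlt ltnS => /predU1P[def_q | le_qp].
  have /(prime_oddPn q_pr) q2 : ~~ odd q by rewrite def_q /= odd_p.
  by move: def_q (prime_gt1 p_pr); rewrite q2 => -[<-].
have def_q : q = pdiv e by apply/eqP; rewrite eqn_leq le_qp.
move: q_p; rewrite def_q -addn1 dvdn_addr // dvdn1.
by rewrite (gtn_eqF (prime_gt1 p_pr)).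
Qed.

Lemma exponent2_abelian (gT : finGroupType) (G : {group gT}) :
  {in G, forall x, x ^+ 2 = 1} -> abelian G.
Proof.
move=> G2; apply/centsP=> x Gx y Gy.
have invE z : z \in G -> z^-1 = z.
  by move=> /G2 z2; apply/eqP; rewrite eq_invg_mul -z2 expgS expg1.
by rewrite /commute -[LHS]invE ?groupM // invMg !invE.
Qed.

(* The map [x |-> x^-1 * f x] is injective, hence onto, and [f] inverts its
   values. *)
Lemma fixfree_involution_invg (gT : finGroupType) (f : gT -> gT) :
    {morph f : x y / x * y} -> involutive f -> (forall x, f x = x -> x = 1) ->
  f =1 (fun x => x^-1).
Proof.
move=> fM fK fix1 y.
have f1 : f 1 = 1 by apply: (mulgI (f 1)); rewrite -fM !mulg1.
have fV x : f x^-1 = (f x)^-1.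
  by apply: (mulgI (f x)); rewrite -fM !mulgV f1.
have inj_c : injective (fun x => x^-1 * f x).
  (* Equal values at [x] and [z] make [x * z^-1] a fixed point of [f]. *)
  move=> x z /= eq_xz; apply/eqP; rewrite eq_mulgV1; apply/eqP/fix1.
  have fE w : f w = w * (w^-1 * f w) by rewrite mulKVg.
  by rewrite fM fV (fE x) (fE z) eq_xz invMg mulgA mulgK.
have [c _ cK] := injF_bij inj_c.
by rewrite -(cK y) fM fV fK invMg invgK.
Qed.

Lemma morph_invg_abelian (gT : finGroupType) (G : {group gT}) :
  {morph (fun x : gT => x^-1) : x y / x * y} -> abelian G.
Proof.
move=> invM; apply/centsP=> x _ y _.
by apply: invg_inj; rewrite invM invMg.
Qed.

Section FNearRing.

Variables (N : finGroupType) (mul : N -> N -> N) (one : N).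
Hypothesis fN : f_near_ring mul one.

Let mulA : associative mul.
Proof. by case: fN => -[]. Qed.

Let mulDl a b c : mul (a * b) c = mul a c * mul b c.
Proof. by case: fN => -[_ ->]. Qed.

Let mul1n : left_id one mul.
Proof. by case: fN => _ _ []. Qed.

Let muln1 : right_id one mul.
Proof. by case: fN => _ _ []. Qed.

Let mul0n : left_zero 1 mul.
Proof. by case: fN => _ []. Qed.

Lemma near_ring_mulX a b k : mul (a ^+ k) b = mul a b ^+ k.
Proof. by elim: k => [|k IHk]; rewrite ?mul0n // !expgS mulDl IHk. Qed.

Lemma near_ring_mul1X k n : mul (one ^+ k) n = n ^+ k.
Proof. by rewrite near_ring_mulX mul1n. Qed.

Lemma near_ring_expg_order_one (n : N) : n ^+ #[one] = 1.
Proof. by rewrite -near_ring_mul1X expg_order mul0n. Qed.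

Lemma near_ring_unitX k : coprime k #[one] -> near_ring_unit mul one (one ^+ k).
Proof.
(* [l] inverts [k] modulo the order of [one]. *)
move=> cop; pose l : nat := expg_invn <[one]> k.
have kl : one ^+ k ^+ l = one.
  by rewrite expgK ?cycle_id // coprime_sym.
exists (one ^+ l); rewrite !near_ring_mul1X.
by rewrite -expgM mulnC expgM kl.
Qed.

(** Evaluating [psi u] at [one] gives [u], so [psi u] is the identity only for [u = one]. *)
Lemma f_near_ring_unit_fix u n :
  near_ring_unit mul one u -> u != one -> mul n u = n -> n = 1.
Proof.
move=> Uu u_neq1; apply: (f_near_ring_fixfree fN Uu) => psi_id.
by case/eqP: u_neq1; rewrite -[RHS]psi_id /psi mul1n.
Qed.

(** Right multiplication by the unit [one ^+ k.+1] fixes the nonzero element [one ^+ j], so this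
    unit must be [one]. *)
Lemma f_near_ring_multiple_fix k j :
    coprime k.+1 #[one] -> #[one] %| j * k -> ~~ (#[one] %| j) ->
  #[one] %| k.
Proof.
move=> cop e_jk; apply: contraR => e_k; rewrite order_dvdn; apply/eqP.
apply: (f_near_ring_unit_fix (near_ring_unitX cop)).
  by rewrite expgS -[X in _ != X]mulg1 (inj_eq (mulgI _)) -order_dvdn.
rewrite near_ring_mul1X -expgM mulnC mulnS expgD.
by move: e_jk; rewrite order_dvdn => /eqP->; rewrite mulg1.
Qed.

Lemma f_near_ring_prime_order_one : 1 < #[one] -> prime #[one].
Proof.
move=> e_gt1; have p_pr := pdiv_prime e_gt1; have e_gt0 := ltnW e_gt1.
pose p := pdiv #[one]; pose j := #[one] %/ p.
have ejp : (j * p)%N = #[one] by rewrite divnK ?pdiv_dvd.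
have j_lt_e : j < #[one] by rewrite ltn_Pdiv ?prime_gt1.
have j_gt0 : 0 < j by rewrite divn_gt0 ?pdiv_gt0 // dvdn_leq ?pdiv_dvd.
have e_j : ~~ (#[one] %| j) by rewrite gtnNdvd.
suffices e_p : #[one] %| p.
  suffices -> : #[one] = p by [].
  by apply/eqP; rewrite eqn_dvd e_p pdiv_dvd.
case: (boolP (odd p)) => [odd_p | even_p].
  (* Take [k = p]: then [j * k] is the order itself. *)
  apply: (f_near_ring_multiple_fix (coprime_pdiv_succ e_gt1 odd_p) _ e_j).
  by rewrite ejp.
have p2 : p = 2 := prime_oddPn p_pr even_p.
(* Take [k = #[one] - 2], so that the unit is [one^-1]; the order divides [k] exactly when it
   divides 2. *)
rewrite p2 -(@dvdn_addr (#[one] - 2)) ?subnK //.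
apply: (f_near_ring_multiple_fix (j := j)) => //; last first.
  by rewrite mulnBr -p2 ejp dvdn_sub ?dvdn_mull.
by rewrite -subSn // subSS subn1 coprime_sym coprimenP.
Qed.

Lemma f_near_ring_odd_abelian :
  odd #[one] -> 1 < #[one] -> abelian [set: N].
Proof.
move=> odd_e e_gt1; have e_gt0 := ltnW e_gt1.
have cop : coprime #[one].-1 #[one] by rewrite coprime_sym coprimenP.
have Uu := near_ring_unitX cop.
pose u := one ^+ #[one].-1.
have uV : u = one^-1 by rewrite [RHS]invg_expg.
have uu : mul u u = one.
  by rewrite near_ring_mul1X uV expVgn -/u uV invgK.
have u_neq1 : u != one.
  (* If [one^-1 = one], the order, odd and above 1, would divide 2. *)
  rewrite uV eq_invg_mul -expg2 -order_dvdn.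
  apply: contraL odd_e => /dvdn_leq /= le_e2.
  by have -> : #[one] = 2 by apply/eqP; rewrite eqn_leq le_e2.
have psiV n : psi mul u n = n^-1.
  apply: fixfree_involution_invg => [x y | x | x].
  - exact: mulDl.
  - by rewrite /psi -mulA uu muln1.
  - exact: f_near_ring_unit_fix.
by apply: morph_invg_abelian => x y; rewrite -!psiV /psi mulDl.
Qed.

End FNearRing.

Theorem theorem5p3 (N : finGroupType) (mul : N -> N -> N) (one : N) :
  f_near_ring mul one ->
  exists2 p : nat, prime p & (p.-abelem [set: N])%g.
Proof.
move=> fN; have expN := near_ring_expg_order_one fN.
have [e_le1 | e_gt1] := leqP #[one] 1.
  (* Here [one] is the zero of [N], so [N] is trivial and any prime would do. *)
  exists 2 => //; suffices -> : [set: N] = 1 by exact: abelem1.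
  apply/trivgP/subsetP=> x _; rewrite inE.
  have e1 : #[one] = 1%N by apply/eqP; rewrite eqn_leq e_le1 order_gt0.
  by rewrite -(expN x) e1 expg1.
have e_pr := f_near_ring_prime_order_one fN e_gt1.
exists #[one] => //; apply/abelemP=> //; split=> [|x _]; last exact: expN.
case: (boolP (odd #[one])) => [odd_e | even_e].
  exact: f_near_ring_odd_abelian fN odd_e e_gt1.
have e2 := prime_oddPn e_pr even_e.
by apply: exponent2_abelian => x _; rewrite -e2.
Qed.
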